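(* Let $p<q$ be primes with $p$ odd, let $r\ge 1$ be an integer, and let $n=q^r$. Let $t$ be the integer such that the number of cyclic subgroups of $T_{4n}\times C_p$ equals $|T_{4n}\times C_p|-t$. Then $$t=2q^r(2p-1)-4\tau(q^r).$$
   Context: $T_{4n}$ denotes the dicyclic group of order $4n$, $T_{4n}=\langle \alpha,\beta \mid \alpha^{2n}=e,\ \alpha^n=\beta^2,\ \beta\alpha\beta^{-1}=\alpha^{-1}\rangle$. $C_p$ is the cyclic group of order $p$. $\tau(x)$ is the number of positive divisors of $x$. The trivial subgroup is counted as cyclic. *)

(* Defs.v *)
From mathcomp Require Import all_boot all_order all_algebra all_fingroup.
From mathcomp Require Import all_solvable.

Set Implicit Arguments.
Unset Strict Implicit.
Unset Printing Implicit Defensive.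

Local Open Scope group_scope.

(* G is isomorphic to T_{4n} = < a, b | a^(2n) = e, a^n = b^2, bab^-1 = a^-1 >.
   "\isog Grp" says that G is the largest finite quotient of the presented
   group; as the presented group is finite (of order 4n) for n > 0, this means
   that G is isomorphic to it.  For n = 0 the presented group is infinite. *)
Definition is_dicyclic (n : nat) (gT : finGroupType) (G : {set gT}) : Prop :=
  G \isog Grp (a : b : a ^+ (2 * n) = 1, a ^+ n = b ^+ 2, b * a * b^-1 = a^-1).

Definition num_cyclic_subgroups (gT : finGroupType) (G : {set gT}) : nat :=
  #|[set H in subgroups G | cyclic H]|.

Definition tau (x : nat) : nat := size (divisors x).

(* Main.v *)
Require Import Defs.
From mathcomp Require Import all_boot all_order all_algebra all_fingroup.
From mathcomp Require Import all_solvable.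
From mathcomp Require Import zify.

(** Since [p] is coprime to [4 * n], a cyclic subgroup of [T x C] is a product of
    cyclic subgroups of [T] and of [C], so their number is twice that of [T].
    The order of [T] is [4 * n]: it divides [4 * n] by the relations, and is a
    multiple of [4] and [2 * n] because, [n] being odd, [T] maps onto [Z/4] and
    onto the dihedral group of order [2 * n].  The cyclic subgroups inside [<a>]
    are counted by [tau (2 * n)]; the [2 * n] elements outside [<a>] have order
    4, and each remaining cyclic subgroup contains two of them. *)

Import GRing.Theory Num.Theory.
Local Open Scope group_scope.

(** A subgroup of a cyclic group is determined by its order, and each divisor [d] of the order of a
    generator [x] is realised by the powers of [x ^+ (#[x] %/ d)]. *)
Lemma num_cyclic_subgroups_cyclic (gT : finGroupType) (G : {group gT}) :
  cyclic G -> num_cyclic_subgroups G = tau #|G|.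
Proof.
move=> cycG; rewrite /num_cyclic_subgroups /tau.
set S := [set _ in _ | _].
rewrite cardE -(size_map (fun H : {group gT} => #|H|)); apply: perm_size.
have inS H : (H \in S) = (H \subset G).
  rewrite inE inE; case sHG: (H \subset G) => //=.
  exact: cyclicS sHG cycG.
apply: uniq_perm (divisors_uniq _) _ => [|d].
  rewrite map_inj_in_uniq ?enum_uniq // => H K.
  rewrite !mem_enum !inS => sHG sKG eqHK; apply/val_inj/eqP => /=.
  by rewrite (eq_subG_cyclic cycG) // eqHK.
rewrite -dvdn_divisors ?cardG_gt0 //; apply/mapP/idP => [[H]|dvd_d].
  by rewrite mem_enum inS => sHG ->; apply: cardSg.
have [x defG] := cyclicP cycG.
exists <[x ^+ (#[x] %/ d)]>%G.
  by rewrite mem_enum inS /= defG cycle_subG mem_cycle.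
rewrite -orderE orderXdiv.
  by rewrite divnA ?mulKn ?order_gt0 // /order -defG.
by rewrite dvdn_div // /order -defG.
Qed.

(** The orders of [x] and [y] divide that of [(x, y)], so by coprimality their product does too; the
    obvious inclusion is then an equality by cardinality. *)
Lemma pair_cycle_coprime (aT bT : finGroupType) (x : aT) (y : bT) :
  coprime #[x]%g #[y]%g -> (<[(x, y)]> = setX <[x]> <[y]>)%g.
Proof.
move=> co_xy; apply/eqP; rewrite eqEcard; apply/andP; split.
  by rewrite cycle_subG in_setX !cycle_id.
rewrite cardsX; apply: dvdn_leq; first exact: order_gt0.
have expE k : ((x, y) ^+ k = (x ^+ k, y ^+ k))%g.
  by elim: k => // k IHk; rewrite !expgS IHk.
have := expg_order (x, y); rewrite expE => -[/eqP xk /eqP yk].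
by rewrite Gauss_dvd // -[X in _ && (X %| _)]/(#[y]%g) !order_dvdn xk yk.
Qed.

(** The injective map sending [(K, L)] to [setX K L] hits every cyclic subgroup: one generated by
    [(x, y)] is the product of [<[x]>] and [<[y]>]. *)
Lemma num_cyclic_subgroups_setX (aT bT : finGroupType)
    (G : {group aT}) (H : {group bT}) : coprime #|G| #|H| ->
  num_cyclic_subgroups (setX G H)
    = (num_cyclic_subgroups G * num_cyclic_subgroups H)%N.
Proof.
move=> coGH; rewrite /num_cyclic_subgroups -cardsX.
pose f (KL : {group aT} * {group bT}) := [group of setX KL.1 KL.2].
rewrite -(@card_in_imset _ _ f) /=; last first.
  move=> [K L] [K' L'] _ _ /(congr1 val) /= eqf.
  have eqin x y : (x \in K) && (y \in L) = (x \in K') && (y \in L').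
    by have /setP/(_ (x, y)) := eqf; rewrite !in_setX.
  congr (_, _); apply/val_inj/setP => z /=.
    by have := eqin z 1%g; rewrite !group1 !andbT.
  by have := eqin 1%g z; rewrite !group1.
apply: eq_card => M; rewrite inE inE; apply/andP/imsetP => [[sM cM]|].
  have [[x y] defM] := cyclicP cM.
  have: (x, y) \in setX G H by rewrite -cycle_subG -defM.
  rewrite in_setX => /andP[Gx Hy].
  exists (<[x]>%G, <[y]>%G).
    by rewrite in_setX !inE !cycle_subG Gx Hy !cycle_cyclic.
  apply: val_inj; rewrite /= defM pair_cycle_coprime //.
  by apply: coprime_dvdl (order_dvdG Gx) (coprime_dvdr (order_dvdG Hy) coGH).
case=> -[K L]; rewrite in_setX !inE /= => /andP[/andP[sK cK] /andP[sL cL]] ->.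
split; first exact: setXS.
have [[x defK] [y defL]] := (cyclicP cK, cyclicP cL).
rewrite /= defK defL -pair_cycle_coprime ?cycle_cyclic //.
by rewrite /order -defK -defL (coprimeSg sK) // (coprimegS sL).
Qed.

(* Read off from the cyclic group [Z/m x Z/n], whose subgroups are counted
   both by [tau (m * n)] and, factor by factor, by [tau m * tau n]. *)
Lemma tauM m n : (1 < m)%N -> (1 < n)%N -> coprime m n ->
  tau (m * n) = (tau m * tau n)%N.
Proof.
move=> m_gt1 n_gt1 co_mn.
have cyc k : cyclic [set: 'Z_k].
  by apply/cyclicP; exists Zp1; apply: Zp_cycle.
have oZ k : (1 < k)%N -> #|[set: 'Z_k]| = k.
  by move=> k1; rewrite cardsT card_ord Zp_cast.
have co : coprime #|[set: 'Z_m]| #|[set: 'Z_n]| by rewrite !oZ.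
have := num_cyclic_subgroups_setX _ _ _ _ co.
rewrite !num_cyclic_subgroups_cyclic //= ?cardsX ?oZ //.
rewrite (Zp_cycle m.-2.+1) (Zp_cycle n.-2.+1) -pair_cycle_coprime ?cycle_cyclic //.
by rewrite !order_Zp1 !Zp_cast.
Qed.

Lemma dicyclic_structure n (gT : finGroupType) (T : {group gT}) :
    odd n -> (1 < n)%N -> is_dicyclic n T ->
  exists A : {group gT}, [/\ A \subset T, cyclic A, #|A| = (2 * n)%N,
    #|T| = (4 * n)%N & {in T :\: A, forall x, #[x] = 4}].
Proof.
move=> odd_n n_gt1 dicT; have n_gt0 := ltnW n_gt1.
have /existsP[[a b] /= /eqP[defT a2n an b_a]] := isoGrp_hom dicT.
have Vconj c : c \in <[a]> -> b * c * b^-1 = c^-1.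
  case/cycleP=> i ->; rewrite -expgVn -b_a.
  by rewrite -[X in X * _ * _]invgK -mulgA -conjgE conjXg conjgE invgK mulgA.
have nAb : b \in 'N(<[a]>).
  by rewrite -groupV -cycle_subG norms_cycle conjgE invgK mulgA b_a groupV cycle_id.
have Ab2 : b ^+ 2 \in <[a]> by rewrite -an mem_cycle.
have sAT : <[a]> \subset T by rewrite -defT joing_subl.
have Tb : b \in T by rewrite -cycle_subG -defT joing_subr.
have nAT : T \subset 'N(<[a]>) by rewrite -defT join_subG normG cycle_subG.
have indexT : #|T : <[a]>| %| 2.
  rewrite -card_quotient // -defT quotientYidl ?cycle_subG // quotient_cycle //.
  by rewrite -orderE order_dvdn -morphX // /= coset_id.
have oa_dvd : #[a] %| 2 * n by rewrite order_dvdn a2n.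
have dvd4 : 4 %| #|T|.
  have: [set: 'Z_4] \homg T.
    (* The group law here is addition. Sending [a] to 2 and [b] to 1 respects [a ^+ n = b ^+ 2]
       because 2n = 2 mod 4 for odd [n]. *)
    have two2 : (2%R : 'Z_4) ^+ 2 = 1 by apply: val_inj.
    rewrite dicT; apply/existsP; exists (2%R : 'Z_4, 1%R : 'Z_4).
    rewrite /= !xpair_eqE /=; apply/and4P; split.
    - by rewrite eqEsubset subsetT /= -Zp_cycle joing_subr.
    - by rewrite expgM two2 expg1n.
    - rewrite -[n]odd_double_half odd_n -mul2n expgD expgM two2 expg1n mulg1.
      exact/eqP/val_inj.
    - exact/eqP/val_inj.
  by move/card_homg; rewrite cardsT card_ord.
have dvd2n : 2 * n %| #|T|.
  have: 'D_(n.*2) \homg T.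
    rewrite dicT.
    (* Send [a] to the rotation [x] and [b] to the reflection [y]: then [x ^+ n] and [y ^+ 2] are
       both trivial. *)
    have /existsP[[x y] /= /eqP[defD xn y2 xy]] := isoGrp_hom (Grp_dihedral n_gt1).
    have Vy : y^-1 = y by apply/eqP; rewrite eq_invg_mul -[y * y]/(y ^+ 2) y2.
    have yx : y * x * y^-1 = x^-1 by rewrite -xy conjgE Vy mulgA.
    by apply/existsP; exists (x, y); rewrite /= defD yx y2 mulnC expgM xn expg1n.
  by move/card_homg; rewrite card_dihedral // mul2n.
have oT_dvd : 4 * n %| #|T|.
  have co4n : coprime 4 n by rewrite (coprime_pexpl 2 n (isT : 0 < 2)) coprime2n.
  by rewrite Gauss_dvd // dvd4 (dvdn_trans _ dvd2n) ?dvdn_mull.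
have lagr := Lagrange sAT; rewrite -orderE in lagr.
have oa_le : #[a] <= 2 * n by apply: dvdn_leq oa_dvd; rewrite muln_gt0.
have index_le : #|T : <[a]>| <= 2 by apply: dvdn_leq indexT.
have oT_ge : 4 * n <= #|T| by apply: dvdn_leq oT_dvd.
(* The factors of [#|T|] are at most 2n and 2 while their product is at least 4n, so all bounds are
   attained. *)
have [oa oT] : #[a] = (2 * n)%N /\ #|T| = (4 * n)%N.
  move: lagr oa_le index_le oT_ge; move: #[a] #|T : _| #|T| => o i c.
  by nia.
exists <[a]>%G; split; rewrite ?cycle_cyclic // => x /setDP[Tx notAx].
have ob2 : #[b ^+ 2] = 2 by rewrite -an orderXdiv oa ?dvdn_mull // mulnK.
(* As [b ^+ 2] has order 2, this makes the order of [x] divide 4 but not 2. *)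
suff x2 : x ^+ 2 = b ^+ 2.
  have o4 : #[x] %| 4 by rewrite order_dvdn (expgM x 2 2) x2 -order_dvdn ob2.
  have o2 : ~~ (#[x] %| 2) by rewrite order_dvdn x2 -order_eq1 ob2.
  have : #[x] \in divisors 4 by rewrite -dvdn_divisors.
  by rewrite !inE => /or3P[] /eqP ox; move: o2; rewrite ox.
have: x \in <[a]> * <[b]> by rewrite -norm_joinEr ?cycle_subG // defT.
case/mulsgP=> u v Au /cycleP[j ->] defx.
(* Even powers of [b] are absorbed into [<[a]>]; the exponent [j] is odd since [x] lies outside
   [<[a]>]. *)
have [c Ac {}defx] : exists2 c, c \in <[a]> & x = c * b.
  rewrite -(odd_double_half j) addnC expgD -mul2n expgM mulgA in defx.
  have Ac : u * b ^+ 2 ^+ j./2 \in <[a]> by apply: groupM Au (groupX _ Ab2).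
  case: (odd j) defx => defx; first by exists (u * b ^+ 2 ^+ j./2).
  by case/negP: notAx; rewrite defx mulg1.
have bc : b * c = c^-1 * b by rewrite -(Vconj c Ac) mulgKV.
by rewrite defx !(expgS _ 1) !expg1 -mulgA (mulgA b) bc !mulgA mulgV mul1g.
Qed.

Lemma num_cyclic_subgroups_index2 n (gT : finGroupType) (T A : {group gT}) :
    A \subset T -> cyclic A -> #|A| = (2 * n)%N -> #|T| = (4 * n)%N ->
    {in T :\: A, forall x, #[x] = 4} ->
  num_cyclic_subgroups T = (tau (2 * n) + n)%N.
Proof.
move=> sAT cycA oA oT ord4; rewrite -oA -num_cyclic_subgroups_cyclic //.
rewrite /num_cyclic_subgroups -(cardsID [set H : {group gT} | H \subset A]).
congr (_ + _)%N.
  apply: eq_card => H; rewrite !inE andbAC; congr (_ && _).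
  by apply/andb_idl => sHA; apply: subset_trans sAT.
set S := _ :\: _.
have oD : #|T :\: A| = (n * 2)%N by rewrite cardsDS // oT oA; lia.
apply/eqP; rewrite -(eqn_pmul2r (isT : 0 < 2)) -oD; apply/eqP.
rewrite -sum_nat_const -sum1_card.
have inS x : x \in T :\: A -> <[x]>%G \in S.
  by case/setDP=> Tx nAx; rewrite !inE /= !cycle_subG Tx nAx cycle_cyclic.
(* Double counting: the fibre over [H] is the set of generators of [H], all outside [A] because [H]
   is not inside [A]. There are [totient 4], that is 2, of them. *)
rewrite [RHS](partition_big (fun x => <[x]>%G) (mem S)) //=.
apply: eq_bigr => H; rewrite !inE => /andP[nsHA /andP[sHT /cyclicP[y defH]]].
have Dy : y \in T :\: A by rewrite inE -!cycle_subG -defH nsHA.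
rewrite sum1dep_card -[LHS]/(totient 4) -(ord4 y Dy) totient_gen.
apply: eq_card => x; rewrite !inE /generator -defH.
apply/eqP/andP => [eqHx|[_ /eqP <-] //].
by rewrite -!cycle_subG -eqHx nsHA sHT; split=> //; apply/eqP/val_inj.
Qed.

Local Open Scope ring_scope.

Theorem theorem5p3 (p q r n : nat)
    (p_pr : prime p) (q_pr : prime q) (ltpq : (p < q)%N) (p_odd : odd p)
    (r_ge1 : (1 <= r)%N) (def_n : n = (q ^ r)%N)
    (gT cT : finGroupType) (T : {group gT}) (C : {group cT})
    (T_dic : is_dicyclic n T)
    (C_cyclic : cyclic C) (C_order : #|C| = p)
    (t : int)
    (def_t : (num_cyclic_subgroups (setX T C))%:Z = #|setX T C|%:Z - t) :
  t = 2 * q%:Z ^+ r * (2 * p%:Z - 1) - 4 * (tau (q ^ r))%:Z.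
Proof.
have p_gt1 := prime_gt1 p_pr; have q_gt2 : (2 < q)%N by lia.
have odd_q : odd q by case: (even_prime q_pr) => // q2; rewrite q2 in q_gt2.
have odd_n : odd n by rewrite def_n oddX odd_q orbT.
have n_gt1 : (1 < n)%N by rewrite def_n -(exp1n r) ltn_exp2r // ltnW.
have [A [sAT cycA oA oT ord4]] := dicyclic_structure _ _ _ odd_n n_gt1 T_dic.
have co_TC : coprime #|T| #|C|.
  rewrite oT C_order coprimeMl (coprime_pexpl 2 p (isT : 0 < 2)%N) coprime2n p_odd.
  by rewrite def_n coprime_pexpl // prime_coprime // dvdn_prime2 // gtn_eqF.
move: def_t; rewrite num_cyclic_subgroups_setX // cardsX oT C_order.
rewrite (num_cyclic_subgroups_index2 _ _ _ _ sAT cycA oA oT ord4).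
rewrite tauM ?coprime2n // (num_cyclic_subgroups_cyclic _ _ C_cyclic) C_order.
have tau_prime d : prime d -> tau d = 2.
  move=> d_pr; suff /perm_size : perm_eq (divisors d) [:: 1%N; d] by [].
  apply: uniq_perm; rewrite ?divisors_uniq //= ?inE ?andbT ?ltn_eqF ?prime_gt1 //.
  move=> e; rewrite -dvdn_divisors ?prime_gt0 // !inE.
  apply/idP/orP => [|[] /eqP -> //].
  by case/primeP: d_pr => _ /[apply] /orP.
have -> : q%:Z ^+ r = n%:Z by rewrite def_n -!natz natrX.
(* The count is now 2(2 tau(n) + n), to be subtracted from the group order 4np. *)
by rewrite (tau_prime 2) // (tau_prime p) // -def_n; lia.
Qed.
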